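(* Let $X$ be a uniformly convex and uniformly smooth Banach space, let $c\in X$, $r>0$, and let $C=B(c,r)$ be the closed ball in $X$ with center $c$ and radius $r$. Then $P_C$ is directionally differentiable on $X$ such that, for every $v\in X$ with $v\neq\theta$, we have: (i) for any $x\in (B(c,r))^o$, $P_C'(x)(v)=v$; (ii) for any $x\in X\setminus B(c,r)$, $$P_C'(x)(v)=\frac{r}{\|x-c\|^2}\left(\|x-c\|\,v-\psi\left(\frac{x-c}{\|x-c\|},\frac{v}{\|v\|}\right)\|v\|\,(x-c)\right);$$ (iii) for any $x\in S(c,r)$, (a) $P_C'(x)(v)=v-\frac{\|v\|}{r}\,\psi\left(\frac{x-c}{\|x-c\|},\frac{v}{\|v\|}\right)(x-c)$ if $v\in x^{\uparrow}_{(c,r)}$; (b) $P_C'(x)(v)=v$ if $v\in x^{\downarrow}_{(c,r)}$.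
   Context: All Banach spaces are real and $\theta$ is the origin. $B(c,r)$, $(B(c,r))^o$, $S(c,r)$ are the closed ball, open ball and sphere with center $c$ and radius $r$; $S(X)$ is the unit sphere of $X$. For a nonempty closed convex $C\subseteq X$, $P_C:X\to C$ is the (single-valued) metric projection: $\|x-P_C(x)\|\le\|x-z\|$ for all $z\in C$. $P_C$ is directionally differentiable at $x$ if for each $v\in X\setminus\{\theta\}$ the norm limit $P_C'(x)(v)=\lim_{t\downarrow0}\frac{P_C(x+tv)-P_C(x)}{t}$ exists in $X$; it is directionally differentiable on $X$ if this holds at every $x\in X$. The function of smoothness of $X$ is $\psi:S(X)\times S(X)\to\mathbb{R}$, $\psi(x,v)=\lim_{t\downarrow0}\frac{\|x+tv\|-\|x\|}{t}$. For $x\in S(c,r)$ and $v\in X\setminus\{\theta\}$: $v\in x^{\uparrow}_{(c,r)}$ iff there is $\delta>0$ with $\|(x+tv)-c\|\ge r$ for all $t\in(0,\delta)$; $v\in x^{\downarrow}_{(c,r)}$ iff there is $\delta>0$ with $\|(x+tv)-c\|<r$ for all $t\in(0,\delta)$. *)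

(* Defs.v *)
From HB Require Import structures.
From mathcomp Require Import all_boot all_order all_algebra.
From mathcomp Require Import all_classical all_reals all_analysis.
Set Implicit Arguments.
Unset Strict Implicit.
Unset Printing Implicit Defensive.
Import Order.TTheory GRing.Theory Num.Theory.
Import numFieldNormedType.Exports.
Local Open Scope classical_set_scope.
Local Open Scope ring_scope.

Definition sphere (R : realType) (X : normedModType R) (c : X) (r : R) : set X :=
  [set x | `|x - c| = r].

Definition uniformly_convex (R : realType) (X : normedModType R) : Prop :=
  forall eps : R, 0 < eps <= 2 ->
  exists2 delta : R, 0 < delta &
    forall x y : X, sphere 0 1 x -> sphere 0 1 y -> eps <= `|x - y| ->
      `|2^-1 *: (x + y)| <= 1 - delta.

(* Equivalently, the modulus of smoothness
   rho(t) = sup {(|x + y| + |x - y|) / 2 - 1 : |x| = 1, |y| = t}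
   satisfies rho(t) / t --> 0 as t decreases to 0. *)
Definition uniformly_smooth (R : realType) (X : normedModType R) : Prop :=
  forall eps : R, 0 < eps ->
  exists2 delta : R, 0 < delta &
    forall x y : X, sphere 0 1 x -> `|y| <= delta ->
      `|x + y| + `|x - y| <= 2 + eps * `|y|.

Definition nearest_points (R : realType) (X : normedModType R) (C : set X)
    (x : X) : set X :=
  [set y | C y /\ forall z, C z -> `|x - y| <= `|x - z|].

(* [get] picks the nearest point; it is the unique one whenever
   [nearest_points C x] is a singleton, as for C nonempty, closed and convex
   in a uniformly convex Banach space. *)
Definition metric_projection (R : realType) (X : normedModType R) (C : set X)
    (x : X) : X :=
  get (nearest_points C x).

Definition dir_quotient (R : realType) (X Y : normedModType R) (f : X -> Y)
    (x v : X) (t : R) : Y :=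
  t^-1 *: (f (x + t *: v) - f x).

Definition dir_derivative (R : realType) (X Y : normedModType R) (f : X -> Y)
    (x v : X) : Y :=
  lim (dir_quotient f x v t @[t --> 0^'+]).

Definition dir_differentiable_at (R : realType) (X Y : normedModType R)
    (f : X -> Y) (x : X) : Prop :=
  forall v : X, v != 0 -> cvg (dir_quotient f x v t @[t --> 0^'+]).

Definition dir_differentiable (R : realType) (X Y : normedModType R)
    (f : X -> Y) : Prop :=
  forall x : X, dir_differentiable_at f x.

(* Meant for x and v on the unit sphere, though defined on all of X * X. *)
Definition smoothness_fun (R : realType) (X : normedModType R) (x v : X) : R :=
  lim (t^-1 * (`|x + t *: v| - `|x|) @[t --> 0^'+]).

(* For x on the sphere with center c and radius r. *)
Definition up_directions (R : realType) (X : normedModType R) (c : X) (r : R)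
    (x : X) : set X :=
  [set v | v != 0 /\ exists2 delta : R, 0 < delta &
    forall t : R, 0 < t < delta -> r <= `|(x + t *: v) - c|].

Definition down_directions (R : realType) (X : normedModType R) (c : X) (r : R)
    (x : X) : set X :=
  [set v | v != 0 /\ exists2 delta : R, 0 < delta &
    forall t : R, 0 < t < delta -> `|(x + t *: v) - c| < r].

(* Main.v *)
Require Import Defs.
From HB Require Import structures.
From mathcomp Require Import all_boot all_order all_algebra.
From mathcomp Require Import all_classical all_reals all_analysis.
From mathcomp Require Import ring lra.
Import Order.TTheory GRing.Theory Num.Theory.
Import numFieldNormedType.Exports.
Local Open Scope classical_set_scope.
Local Open Scope ring_scope.

(** Outside the open ball the metric projection onto the ball with center [c]
    and radius [r] is the radial map [x |-> c + (r / `|x - c|) *: (x - c)]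
    ([metric_projection_radial]): this point is a minimizer by the triangle
    inequality, and uniform convexity makes the minimizer unique
    ([nearest_points_unique]). On the ball the projection is the identity.

    The radial map is built from the norm, and the norm has a one-sided
    derivative along every direction: it is convex along rays, so its difference
    quotients are monotone and bounded below ([smoothness_quotient_cvg]).
    Writing the difference quotient of the radial map in terms of that of the norm and
    passing to the limit gives
    [(r / `|u| ^+ 2) *: (`|u| *: v - D *: u)], where [u = x - c] and [D] is the
    derivative of the norm at [u] along [v]
    ([dir_quotient_projection_radial_cvg]). By homogeneity, [D] is [`|v|] times
    the function of smoothness at the normalized vectors
    ([smoothness_fun_normalize]); on the sphere, [`|u| = r] reduces the formula
    to the one stated for up directions.

    It remains to see which formula for the projection holds along the short ray
    issuing from [x]. At interior and exterior points this is clear by openness.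
    On the sphere, convexity of the norm leaves two possibilities: the ray stays
    out of the open ball, or it runs inside it for a while
    ([up_or_down_directions]). *)

Set Implicit Arguments.
Unset Strict Implicit.

(** * One-sided derivatives of the norm *)

Lemma ray_cvg (R : realType) (X : normedModType R) (x v : X) :
  x + t *: v @[t --> 0^'+] --> x.
Proof.
rewrite -[X in _ --> X]addr0; apply: cvgD; first exact: cvg_cst.
rewrite -[X in _ --> X](scale0r v); apply: cvgZr_tmp.
by apply: cvg_at_right_filter; exact: cvg_id.
Qed.

(** The point [x + s *: v] divides the segment from [x] to [x + t *: v] in the
    ratio [s : t - s]. This inequality gives both the monotonicity of the
    difference quotients of the norm and the alternative between up and down
    directions. *)
Lemma norm_along_ray_convex (R : realType) (X : normedModType R) (x v : X)
    (s t : R) (hs : 0 <= s) (st : s <= t) (ht : 0 < t) :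
  `|x + s *: v| <= (1 - s / t) * `|x| + s / t * `|x + t *: v|.
Proof.
have a0 : 0 <= s / t by rewrite divr_ge0 // ltW.
have a1 : 0 <= 1 - s / t by rewrite subr_ge0 ler_pdivrMr // mul1r.
have -> : x + s *: v = (1 - s / t) *: x + (s / t) *: (x + t *: v).
  rewrite scalerDr scalerA divfK ?gt_eqF // addrA -scalerDl.
  by rewrite subrK scale1r.
by apply: le_trans (ler_normD _ _) _; rewrite 2!normrZ !ger0_norm.
Qed.

(** By convexity the difference quotient of the norm is nondecreasing in [t > 0],
    and by the triangle inequality it stays above [- `|v|]; hence the
    limit that defines [smoothness_fun] exists in every normed space. *)
Lemma smoothness_quotient_cvg (R : realType) (X : normedModType R) (x v : X) :
  t^-1 * (`|x + t *: v| - `|x|) @[t --> 0^'+] --> smoothness_fun x v.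
Proof.
apply: nondecreasing_at_right_is_cvgr.
  apply: nearW => b s t.
  rewrite !in_itv /= => /andP[s0 _] /andP[t0 _] st.
  rewrite ler_pdivrMl // mulrA.
  have := norm_along_ray_convex x v (ltW s0) st t0; lra.
apply: nearW => b; exists (- `|v|) => _ [t + <-].
rewrite /= in_itv /= => /andP[t0 _].
rewrite ler_pdivlMl //.
have := lerB_normD x (t *: v); rewrite normrZ gtr0_norm //.
lra.
Qed.

(** The one-sided derivative of the norm is homogeneous of degree [0] in the
    base point and of degree [1] in the direction: the quotient at step [s] for
    the scaled data is [b] times the quotient at step [b / a * s] for the
    original data. *)
Lemma smoothness_fun_scale (R : realType) (X : normedModType R) (x v : X)
    (a b : R) (ha : 0 < a) (hb : 0 < b) :
  smoothness_fun (a *: x) (b *: v) = b * smoothness_fun x v.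
Proof.
apply: cvg_lim => //; apply/cvg_at_rightP => u [u0 ucv].
have k0 : 0 < b / a by rewrite divr_gt0.
have /cvg_at_rightP/(_ (fun n => b / a * u n)) h :=
  @smoothness_quotient_cvg _ _ x v.
have -> : (fun n => (u n)^-1 * (`|a *: x + u n *: (b *: v)| - `|a *: x|)) =
    (fun n => b * ((b / a * u n)^-1 * (`|x + (b / a * u n) *: v| - `|x|))).
  apply/funext => n.
  have -> : a *: x + u n *: (b *: v) = a *: (x + (b / a * u n) *: v).
    rewrite scalerDr !scalerA; congr (_ + _ *: _).
    by field; rewrite gt_eqF.
  rewrite !normrZ gtr0_norm //.
  by field; rewrite !gt_eqF.
apply: cvgMl_tmp; apply: h; split => [n|]; first by rewrite mulr_gt0.
by rewrite -[X in _ --> X](mulr0 (b / a)); apply: cvgMl_tmp.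
Qed.

(** The product [psi(x/|x|, v/|v|) |v|] is the one-sided derivative of the norm
    at [x] along [v], with no normalization; the derivative formulas below are
    computed in this simpler form. *)
Lemma smoothness_fun_normalize (R : realType) (X : normedModType R) (x v : X) :
  x != 0 -> v != 0 ->
  smoothness_fun (`|x|^-1 *: x) (`|v|^-1 *: v) * `|v| = smoothness_fun x v.
Proof.
move=> x0 v0; rewrite smoothness_fun_scale ?invr_gt0 ?normr_gt0 //.
by rewrite mulrAC mulVf ?mul1r // normr_eq0.
Qed.

(** * The metric projection onto a ball *)

(** If [y] and [z] were two nearest points at distance [d] from [x], then
    [(x - y) / d] and [(x - z) / d] would be distinct unit vectors, and uniform
    convexity would put the midpoint of [y] and [z] strictly closer to [x]. *)
Lemma nearest_points_unique (R : realType) (X : normedModType R)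
    (hconv : uniformly_convex X) (C : set X)
    (hmid : forall y z, C y -> C z -> C (2^-1 *: (y + z))) (x y z : X) :
  nearest_points C x y -> nearest_points C x z -> y = z.
Proof.
move=> [Cy hy] [Cz hz].
have dE : `|x - z| = `|x - y| by apply/eqP; rewrite eq_le hy // hz.
have [d0|d0] := eqVneq `|x - y| 0.
  have /eqP : x - y = 0 by apply/eqP; rewrite -normr_eq0 d0.
  have /eqP : x - z = 0 by apply/eqP; rewrite -normr_eq0 dE d0.
  by rewrite !subr_eq0 => /eqP <- /eqP <-.
have dp : 0 < `|x - y| by rewrite lt_def d0 normr_ge0.
apply/eqP/negPn/negP => yz.
set d := `|x - y| in dE dp d0.
have ndV : `|d^-1| = d^-1 by rewrite gtr0_norm // invr_gt0.
have uE : d^-1 *: (x - y) - d^-1 *: (x - z) = d^-1 *: (z - y).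
  by rewrite -scalerBr opprB addrC addrA subrK.
have yu : sphere 0 1 (d^-1 *: (x - y)).
  by rewrite /sphere /= subr0 normrZ ndV mulVf.
have zu : sphere 0 1 (d^-1 *: (x - z)).
  by rewrite /sphere /= subr0 normrZ ndV dE mulVf.
have eps_itv : 0 < `|d^-1 *: (x - y) - d^-1 *: (x - z)| <= 2.
  rewrite {1}uE normr_gt0 scaler_eq0 invr_eq0 negb_or d0 subr_eq0 eq_sym yz /=.
  rewrite (le_trans (ler_normB _ _)) //.
  move: yu zu; rewrite /sphere /= !subr0 => -> ->; lra.
have [delta delta0 /(_ _ _ yu zu (lexx _))] := hconv _ eps_itv.
have -> : 2^-1 *: (d^-1 *: (x - y) + d^-1 *: (x - z)) =
    d^-1 *: (x - 2^-1 *: (y + z)).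
  rewrite -scalerDr scalerA mulrC -scalerA; congr (_ *: _).
  rewrite addrACA -opprD scalerBr -mulr2n.
  by rewrite -[x *+ 2]scaler_nat scalerA mulVf ?scale1r // pnatr_eq0.
rewrite normrZ ndV mulrC ler_pdivrMr //.
have := hy _ (hmid _ _ Cy Cz); rewrite -/d; nra.
Qed.

Lemma closed_ballP (R : realType) (X : normedModType R) (c : X) (r : R) :
  0 < r -> closed_ball c r = [set x | `|x - c| <= r].
Proof.
move=> r0; rewrite closed_ballE // /closed_ball_.
by apply/funext => x /=; rewrite distrC.
Qed.

Lemma closed_ball_midpoint (R : realType) (X : normedModType R) (c : X)
    (r : R) (hr : 0 < r) (y z : X) :
  closed_ball c r y -> closed_ball c r z ->
  closed_ball c r (2^-1 *: (y + z)).
Proof.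
rewrite closed_ballP //= => hy hz.
have -> : 2^-1 *: (y + z) - c = 2^-1 *: ((y - c) + (z - c)).
  rewrite addrACA -opprD scalerBr -mulr2n -[c *+ 2]scaler_nat scalerA.
  by rewrite mulVf ?scale1r // pnatr_eq0.
rewrite normrZ gtr0_norm ?invr_gt0 //.
have := ler_normD (y - c) (z - c); lra.
Qed.

Lemma metric_projection_id (R : realType) (X : normedModType R) (C : set X)
    (x : X) : C x -> metric_projection C x = x.
Proof.
move=> Cx; apply: get_unique.
  by split=> // z _; rewrite subrr normr0.
move=> y [_ /(_ _ Cx)]; rewrite subrr normr0 normr_le0 subr_eq0.
by move/eqP.
Qed.

(** The radial point is at distance [`|x - c| - r] from [x], and the triangle
    inequality shows that no point of the ball is closer; uniform convexity
    makes it the only minimizer, so that [get] has to return it. On the sphere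
    itself the formula returns [x], which lets the exterior and the
    up-direction cases share one computation. *)
Lemma metric_projection_radial (R : realType) (X : normedModType R)
    (hconv : uniformly_convex X) (c x : X) (r : R) (hr : 0 < r) :
  r <= `|x - c| ->
  metric_projection (closed_ball c r) x = c + (r / `|x - c|) *: (x - c).
Proof.
move=> rx; have n0 : 0 < `|x - c| by rewrite (lt_le_trans hr).
have p_nearest :
    nearest_points (closed_ball c r) x (c + (r / `|x - c|) *: (x - c)).
  rewrite /nearest_points closed_ballP //=; split.
    rewrite addrC addKr normrZ ger0_norm ?divfK ?gt_eqF //.
    by rewrite divr_ge0 // ltW.
  move=> z zr.
  have -> : x - (c + (r / `|x - c|) *: (x - c)) =
      (1 - r / `|x - c|) *: (x - c).
    by rewrite scalerBl scale1r opprD addrA.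
  rewrite normrZ ger0_norm; last by rewrite subr_ge0 ler_pdivrMr // mul1r.
  rewrite mulrBl mul1r divfK ?gt_eqF //.
  have := ler_normD (x - z) (z - c); rewrite addrA subrK; lra.
apply: get_unique => // y hy.
apply: nearest_points_unique hy p_nearest => //; exact: closed_ball_midpoint.
Qed.

(** * Directional derivatives of the projection *)

Lemma dir_derivative_eq (R : realType) (X Y : normedModType R) (f : X -> Y)
    (x v : X) (l : Y) :
  dir_quotient f x v t @[t --> 0^'+] --> l -> dir_derivative f x v = l.
Proof. by move=> h; apply: cvg_lim => //; exact: norm_hausdorff. Qed.

Lemma dir_quotient_projection_id_cvg (R : realType) (X : normedModType R)
    (C : set X) (x v : X) :
  C x -> (\forall t \near 0^'+, C (x + t *: v)) ->
  dir_quotient (metric_projection C) x v t @[t --> 0^'+] --> v.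
Proof.
move=> Cx Ct; apply: cvg_trans (@cvg_cst _ v _ 0^'+ _); apply: near_eq_cvg.
near=> t.
have t0 : 0 < t by near: t; exact: nbhs_right_gt.
rewrite /dir_quotient !metric_projection_id //; last by near: t.
by rewrite addrC addKr scalerA mulVf ?scale1r // gt_eqF.
Unshelve. all: by end_near.
Qed.

(** With [u = x - c] and [n t = `|u + t *: v|], the projection along the ray is
    [c + (r / n t) *: (u + t *: v)], and its difference quotient is exactly
    [(r / n t) *: v - (r / (n t * n 0) * ((n t - n 0) / t)) *: u]. Here [n t]
    tends to [n 0], and the last factor tends to [smoothness_fun u v]. *)
Lemma dir_quotient_projection_radial_cvg (R : realType) (X : normedModType R)
    (hconv : uniformly_convex X) (c x v : X) (r : R) (hr : 0 < r) :
  r <= `|x - c| -> (\forall t \near 0^'+, r <= `|x + t *: v - c|) ->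
  dir_quotient (metric_projection (closed_ball c r)) x v t @[t --> 0^'+] -->
    (r / `|x - c| ^+ 2) *:
      (`|x - c| *: v - smoothness_fun (x - c) v *: (x - c)).
Proof.
move=> rx rt; set u := x - c; have n0 : 0 < `|u| by rewrite (lt_le_trans hr).
have uE t : x + t *: v - c = u + t *: v by rewrite addrAC.
have ncv : `|u + t *: v| @[t --> 0^'+] --> `|u|.
  by apply: cvg_norm; exact: ray_cvg.
have lcv : (r / `|u + t *: v|) *: v - (r / (`|u + t *: v| * `|u|) *
      (t^-1 * (`|u + t *: v| - `|u|))) *: u @[t --> 0^'+] -->
    (r / `|u|) *: v - (r / (`|u| * `|u|) * smoothness_fun u v) *: u.
  apply: cvgB; apply: cvgZr_tmp.
    by apply: cvgMl_tmp; apply: cvgV => //; rewrite gt_eqF.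
  apply: cvgM; last exact: smoothness_quotient_cvg.
  apply: cvgMl_tmp; apply: cvgV; first by rewrite mulf_neq0 ?gt_eqF.
  by apply: cvgMr_tmp.
have -> : (r / `|u| ^+ 2) *: (`|u| *: v - smoothness_fun u v *: u) =
    (r / `|u|) *: v - (r / (`|u| * `|u|) * smoothness_fun u v) *: u.
  rewrite scalerBr !scalerA expr2; congr (_ *: _ - _).
  by field; rewrite gt_eqF.
apply: cvg_trans lcv; apply: near_eq_cvg.
near=> t.
have t0 : 0 < t by near: t; exact: nbhs_right_gt.
have rt' : r <= `|x + t *: v - c| by near: t.
have nt0 : 0 < `|u + t *: v| by rewrite -uE (lt_le_trans hr).
rewrite /dir_quotient !metric_projection_radial // uE -/u; clearbody u.
rewrite opprD addrACA subrr add0r.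
rewrite (scalerDr _ u) addrAC -scalerBl scalerDr !scalerA [RHS]addrC -scaleNr.
congr (_ *: _ + _ *: _); field; rewrite ?gt_eqF//.
Unshelve. all: by end_near.
Qed.

(** If the ray enters the open ball at some [t0], convexity of the norm keeps it
    there for every smaller positive step; otherwise it never enters. Thus at a
    point of the sphere each direction falls under one of the two derivative
    computations, which gives differentiability there. *)
Lemma up_or_down_directions (R : realType) (X : normedModType R) (c x v : X)
    (r : R) :
  sphere c r x -> v != 0 -> up_directions c r x v \/ down_directions c r x v.
Proof.
rewrite /sphere /= => xr v0.
have [[t0 t00 lt_r]|/forall2NP up] :=
    pselect (exists2 t0 : R, 0 < t0 & `|x + t0 *: v - c| < r).
  right; split => //; exists t0 => // t /andP[tp tt0].
  have := norm_along_ray_convex (x - c) v (ltW tp) (ltW tt0) t00.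
  rewrite !(addrAC x (- c)) xr => h.
  have a0 : 0 < t / t0 by rewrite divr_gt0.
  nra.
left; split => //; exists 1 => // t /andP[tp _].
by case: (up t) => // /negP; rewrite -leNgt.
Qed.

Theorem theorem5p2 (R : realType) (X : completeNormedModType R)
  (hconv : uniformly_convex X) (hsmooth : uniformly_smooth X)
  (c : X) (r : R) (hr : 0 < r) :
  dir_differentiable (metric_projection (closed_ball c r)) /\
  forall v : X, v != 0 ->
  [/\ (forall x : X, ball c r x ->
         dir_derivative (metric_projection (closed_ball c r)) x v = v),
      (forall x : X, ~ closed_ball c r x ->
         dir_derivative (metric_projection (closed_ball c r)) x v =
         (r / `|x - c| ^+ 2) *:
           (`|x - c| *: v -
            (smoothness_fun (`|x - c|^-1 *: (x - c)) (`|v|^-1 *: v) * `|v|)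
              *: (x - c))) &
      (forall x : X, sphere c r x ->
         (up_directions c r x v ->
            dir_derivative (metric_projection (closed_ball c r)) x v =
            v - (`|v| / r *
                 smoothness_fun (`|x - c|^-1 *: (x - c)) (`|v|^-1 *: v))
                  *: (x - c)) /\
         (down_directions c r x v ->
            dir_derivative (metric_projection (closed_ball c r)) x v = v))].
Proof.
have ballE : closed_ball c r = [set x | `|x - c| <= r] by exact: closed_ballP.
have inside x v : ball c r x ->
    dir_quotient (metric_projection (closed_ball c r)) x v t @[t --> 0^'+]
      --> v.
  move=> cx; have cx' : nbhs x (closed_ball c r).
    apply: filterS (@subset_closed_ball _ _ c r) _.
    by apply: open_nbhs_nbhs; split => //; exact: ball_open.
  apply: dir_quotient_projection_id_cvg; first exact: nbhs_singleton.
  exact: (@ray_cvg _ _ x v _ cx').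
have outside x v : ~ closed_ball c r x ->
    dir_quotient (metric_projection (closed_ball c r)) x v t @[t --> 0^'+]
      --> (r / `|x - c| ^+ 2) *:
            (`|x - c| *: v - smoothness_fun (x - c) v *: (x - c)).
  move=> cx; have rx : r < `|x - c|.
    by rewrite ltNge; apply/negP; move: cx; rewrite ballE.
  apply: dir_quotient_projection_radial_cvg => //; first exact: ltW.
  have : nbhs x (~` closed_ball c r).
    by apply: open_nbhs_nbhs; split => //;
      exact: closed_openC (@closed_ball_closed _ _ c r).
  move=> /(@ray_cvg _ _ x v _) ct.
  have : \forall t \near 0^'+, ~ closed_ball c r (x + t *: v) by exact: ct.
  apply: filterS => t.
  by rewrite ballE => /negP; rewrite -ltNge => /ltW.
have up x v : sphere c r x -> up_directions c r x v ->
    dir_quotient (metric_projection (closed_ball c r)) x v t @[t --> 0^'+]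
      --> (r / `|x - c| ^+ 2) *:
            (`|x - c| *: v - smoothness_fun (x - c) v *: (x - c)).
  move=> xr [v0 [d d0 hd]].
  apply: dir_quotient_projection_radial_cvg => //; first by rewrite xr.
  by near=> t; apply: hd; apply/andP; split; near: t;
    [exact: nbhs_right_gt|exact: nbhs_right_lt].
have down x v : sphere c r x -> down_directions c r x v ->
    dir_quotient (metric_projection (closed_ball c r)) x v t @[t --> 0^'+]
      --> v.
  move=> xr [v0 [d d0 hd]].
  apply: dir_quotient_projection_id_cvg; first by rewrite ballE /= xr.
  rewrite ballE; near=> t; apply/ltW/hd; apply/andP; split; near: t;
    [exact: nbhs_right_gt|exact: nbhs_right_lt].
split=> [x v v0|v v0].
  have [cx|cx] := pselect (closed_ball c r x); last first.
    by apply/cvg_ex; eexists; exact: outside.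
  have [xr|] := eqVneq `|x - c| r.
    by case: (up_or_down_directions xr v0) => h; apply/cvg_ex; eexists;
      [exact: up|exact: down].
  move=> xr; apply/cvg_ex; eexists; apply: inside.
  rewrite -ball_normE /ball_ /= distrC lt_neqAle xr /=.
  by move: cx; rewrite ballE.
split=> [x cx|x cx|x xr].
- exact: dir_derivative_eq (inside _ _ cx).
- rewrite smoothness_fun_normalize //;
    first exact: dir_derivative_eq (outside _ _ cx).
  apply/eqP => xc; apply: cx; rewrite ballE /= xc normr0; exact: ltW.
- split=> h; last exact: dir_derivative_eq (down _ _ xr h).
  have xc0 : x - c != 0 by rewrite -normr_eq0 xr gt_eqF.
  rewrite (dir_derivative_eq (up _ _ xr h)) -smoothness_fun_normalize //.
  rewrite xr scalerBr !scalerA; congr (_ - _ *: _); last first.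
    by field; rewrite gt_eqF.
  by rewrite expr2 invfM mulrA divfK ?gt_eqF // divff ?scale1r // gt_eqF.
Unshelve. all: by end_near.
Qed.
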